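(* Let $\varphi\colon\mathcal{X}\to\,]-\infty,+\infty]$ be proper, let $W\colon\mathcal{X}\to 2^{\mathcal{X}^*}$, let $u^*\in\mathcal{X}^*$, and let $\gamma\in\,]0,+\infty[$. Suppose that $x\in\operatorname{dom}W$ and that $z\in\operatorname{prox}^W_{\gamma(\varphi-u^* )}x$. Then the following hold: (i) There exist $x^*\in Wx$ and $z^*\in Wz$ such that $L_\varphi(x,u^* )\geq\langle x-z,x^*-z^*\rangle/\gamma$. (ii) Suppose that $W$ is $\phi$-uniformly monotone. Then $L_\varphi(x,u^* )\geq\phi(\|x-z\|)/\gamma$. (iii) Suppose that $W$ is $\alpha$-strongly monotone. Then $L_\varphi(x,u^* )\geq\alpha\|x-z\|^2/\gamma$. (iv) Suppose that $W$ is at most single-valued. Then $L_\varphi(x,u^* )\geq\langle x-z,Wx-Wz\rangle/\gamma$. (v) Let $f\in\Gamma_0(\mathcal{X})$ be Gateaux differentiable on $\operatorname{dom}\nabla f=\operatorname{int\,dom}f$ and suppose that $W=\nabla f$. Then $$L_\varphi(x,u^* )\geq\frac{D_f(x,z)+D_f(z,x)}{\gamma}.$$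
   Context: $\mathcal{X}\neq\{0\}$ is a reflexive real Banach space with topological dual $\mathcal{X}^*$, and $\langle\cdot,\cdot\rangle$ is the canonical duality pairing. A function $\varphi\colon\mathcal{X}\to\,]-\infty,+\infty]$ is proper if $\operatorname{dom}\varphi=\{\varphi<+\infty\}\neq\varnothing$; its conjugate is $\varphi^*\colon x^*\mapsto\sup_{x}(\langle x,x^*\rangle-\varphi(x))$; its Fenchel--Young function is $L_\varphi\colon(x,u^* )\mapsto\varphi(x)+\varphi^*(u^* )-\langle x,u^*\rangle$; its subdifferential (no convexity required) is $\partial\varphi\colon x\mapsto\{x^*\in\mathcal{X}^*\mid(\forall y\in\mathcal{X})\ \langle y-x,x^*\rangle+\varphi(x)\leq\varphi(y)\}$. $\varphi-u^*$ denotes the function $y\mapsto\varphi(y)-\langle y,u^*\rangle$. For $W\colon\mathcal{X}\to 2^{\mathcal{X}^*}$: $\operatorname{gra}W=\{(x,x^* )\mid x^*\in Wx\}$, $\operatorname{dom}W=\{x\mid Wx\neq\varnothing\}$, $W^{-1}x^*=\{x\mid x^*\in Wx\}$; images of sets and compositions are unions of images. The warped proximity operator of $\varphi$ with kernel $K\colon\mathcal{X}\to2^{\mathcal{X}^*}$ is $\operatorname{prox}_\varphi^K=(K+\partial\varphi)^{-1}\circ K$. For an increasing $\phi\colon[0,+\infty[\,\to[0,+\infty]$ vanishing only at $0$, $W$ is $\phi$-uniformly monotone if $\langle x-y,x^*-y^*\rangle\geq\phi(\|x-y\|)$ for all $(x,x^* ),(y,y^* )\in\operatorname{gra}W$; it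 is $\alpha$-strongly monotone, $\alpha\in\,]0,+\infty[$, if this holds with $\phi=\alpha|\cdot|^2$. $W$ is at most single-valued if each $Wx$ has at most one element, in which case $Wx$ also denotes that element for $x\in\operatorname{dom}W$. $\Gamma_0(\mathcal{X})$ is the class of proper lower semicontinuous convex functions from $\mathcal{X}$ to $]-\infty,+\infty]$. If $f\in\Gamma_0(\mathcal{X})$ is Gateaux differentiable on $\operatorname{int\,dom}f\neq\varnothing$, the Bregman distance is $D_f(x,y)=f(x)-f(y)-\langle x-y,\nabla f(y)\rangle$ if $y\in\operatorname{int\,dom}f$, and $D_f(x,y)=+\infty$ otherwise. *)

(* Defs.v *)
From HB Require Import structures.
From mathcomp Require Import all_boot all_order all_algebra.
From mathcomp Require Import all_classical all_reals all_analysis.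

Set Implicit Arguments.
Unset Strict Implicit.
Unset Printing Implicit Defensive.

Import Order.TTheory GRing.Theory Num.Theory.
Import numFieldNormedType.Exports.

Local Open Scope classical_set_scope.
Local Open Scope ring_scope.

(* The dual is a submodule of the pointwise module X -> R, so that sums,
   differences and multiples of functionals are the ones of the library. *)
Section dual_lmodule.
Context {R : realType} {X : normedModType R}.

Definition dual_pred : {pred X -> R^o} :=
  [pred u : X -> R^o | `[< linear u /\ continuous u >]].

Record topdual := Dual { dual_fun :> X -> R^o; _ : dual_fun \in dual_pred }.

HB.instance Definition _ := [isSub for dual_fun].
HB.instance Definition _ := [Choice of topdual by <:].

Lemma dual_pred_submod : submod_closed dual_pred.
Proof.
split.
  apply/asboolP; split; last by move=> x; exact: cvg_cst.
  by move=> a x y; rewrite /= scaler0 addr0.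
move=> a u v /asboolP[lu cu] /asboolP[lv cv]; apply/asboolP; split.
  move=> b x y; rewrite addrfctE scalrfctE lu lv !scalerDr !scalerA.
  by rewrite [b * a]mulrC addrACA.
by move=> x; apply: cvgD; [apply: cvgZr; exact: cu|exact: cv].
Qed.

HB.instance Definition _ :=
  GRing.isSubmodClosed.Build R (X -> R^o) dual_pred dual_pred_submod.
HB.instance Definition _ := [SubChoice_isSubLmodule of topdual by <:].

Lemma dual_linear (u : topdual) : linear (u : X -> R^o).
Proof. by case: u => u /= /asboolP[]. Qed.

HB.instance Definition _ (u : topdual) :=
  GRing.isLinear.Build R X R^o _ (dual_fun u) (dual_linear u).

Lemma dual_continuous (u : topdual) : continuous (u : X -> R^o).
Proof. by case: u => u /= /asboolP[]. Qed.

End dual_lmodule.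
Arguments topdual {R} X.

Section dual_norm.
Context {R : realType} {X : normedModType R}.
Implicit Types u v : topdual X.

Definition dual_norm u : R := sup [set `|u x| | x in [set x : X | `|x| <= 1]].

Lemma dual_norm_has_sup u :
  has_sup [set `|u x| | x in [set x : X | `|x| <= 1]].
Proof.
split; first by exists `|u 0|, 0; rewrite //= normr0.
have /bounded_funP/(_ 1)[M uM] :=
  continuous_linear_bounded 0 (@dual_continuous _ _ u 0).
by exists M => _ [x x1 <-]; exact: uM.
Qed.

Lemma le_dual_norm u x : `|x| <= 1 -> `|u x| <= dual_norm u.
Proof.
by move=> x1; apply: ub_le_sup; [case: (dual_norm_has_sup u)|exists x].
Qed.

Lemma dual_norm_le u (M : R) :
  (forall x, `|x| <= 1 -> `|u x| <= M) -> dual_norm u <= M.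
Proof.
move=> uM; apply: ge_sup; first by case: (dual_norm_has_sup u).
by move=> _ [x x1 <-]; exact: uM.
Qed.

Lemma dual_norm_ge0 u : 0 <= dual_norm u.
Proof. by apply: le_trans (@le_dual_norm u 0 _); rewrite ?normr0. Qed.

Lemma ler_dual_normD u v : dual_norm (u + v) <= dual_norm u + dual_norm v.
Proof.
apply: dual_norm_le => x x1.
by rewrite (le_trans (ler_normD _ _))// lerD// le_dual_norm.
Qed.

Lemma dual_normZ (a : R) u : dual_norm (a *: u) = `|a| * dual_norm u.
Proof.
have le_ b v : dual_norm (b *: v) <= `|b| * dual_norm v.
  apply: dual_norm_le => x x1.
  by rewrite normrM ler_wpM2l// le_dual_norm.
apply/eqP; rewrite eq_le le_/=.
have [->|a0] := eqVneq a 0; first by rewrite normr0 mul0r dual_norm_ge0.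
rewrite -ler_pdivlMl ?normr_gt0// -normfV -[in leLHS](scale1r u).
by rewrite -(mulVf a0) -scalerA le_.
Qed.

Lemma dual_norm0_eq0 u : dual_norm u = 0 -> u = 0.
Proof.
move=> u0; apply/val_inj/funext => x /=.
have [->|x0] := eqVneq x 0; first by rewrite linear0.
have : `|u (`|x|^-1 *: x)| <= 0.
  by rewrite -u0 le_dual_norm// normrZ normfV normr_id mulVf ?normr_eq0.
rewrite linearZ normr_le0 scaler_eq0 invr_eq0 normr_eq0 (negbTE x0)/=.
by move/eqP.
Qed.

HB.instance Definition _ := Lmodule_isNormed.Build R (topdual X)
  ler_dual_normD dual_normZ dual_norm0_eq0.

End dual_norm.

Definition pairing {R : realType} {X : normedModType R} (x : X) (u : topdual X) : R :=
  u x.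

(* Surjectivity of the canonical embedding of X into its bidual, both duals
   carrying the operator norm. *)
Definition reflexive_space {R : realType} (X : normedModType R) :=
  forall xi : topdual (topdual X), exists x : X, forall u : topdual X, xi u = u x.

Section set_valued_operators.
Context {T U S : Type}.

Definition sdom (W : T -> set U) : set T := [set x | W x !=set0].

Definition sinv (W : T -> set U) : U -> set T := fun u => [set x | W x u].

Definition scomp (V : U -> set S) (W : T -> set U) : T -> set S :=
  fun x => \bigcup_(u in W x) V u.

Definition at_most_single_valued (W : T -> set U) := forall x, is_subset1 (W x).

End set_valued_operators.

Definition sadd {T : Type} {V : zmodType} (A B : T -> set V) : T -> set V :=
  fun x => [set a + b | a in A x & b in B x].

(* The element of W x when W x is a singleton; meaningful only for x in sdom W. *)
Definition svalue {T : Type} {V : zmodType} (W : T -> set V) (x : T) : V :=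
  xget 0 (W x).

Local Open Scope ereal_scope.

Section convex_analysis.
Context {R : realType} {X : normedModType R}.
Implicit Types (phi f : X -> \bar R) (u : topdual X) (W K : X -> set (topdual X)).

Definition edom phi : set X := [set x | phi x < +oo].

Definition proper_efun phi := (forall x, -oo < phi x) /\ edom phi !=set0.

Definition conjugate phi u : \bar R :=
  ereal_sup [set (pairing x u)%:E - phi x | x in [set: X]].

Definition fenchel_young phi (x : X) u : \bar R :=
  phi x + conjugate phi u - (pairing x u)%:E.

Definition subdifferential phi (x : X) : set (topdual X) :=
  [set u | forall y, (pairing (y - x)%R u)%:E + phi x <= phi y].

Definition warped_prox K phi : X -> set X :=
  scomp (sinv (sadd K (subdifferential phi))) K.

(* Increasing (in the wide sense) functions from [0, +oo[ to [0, +oo] that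
   vanish only at 0; the values on ]-oo, 0[ are irrelevant. *)
Definition modulus (psi : R -> \bar R) :=
  [/\ forall t : R, (0 <= t)%R -> 0 <= psi t,
      forall s t : R, (0 <= s)%R -> (s <= t)%R -> psi s <= psi t &
      forall t : R, (0 <= t)%R -> (psi t = 0 <-> t = 0%R)].

Definition uniformly_monotone (psi : R -> \bar R) W :=
  forall (x y : X) (u v : topdual X), W x u -> W y v ->
    psi `|x - y|%R <= (pairing (x - y)%R (u - v)%R)%:E.

Definition strongly_monotone (alpha : R) W :=
  uniformly_monotone (fun t => (alpha * t ^+ 2)%:E) W.

Definition convex_efun f :=
  forall (x y : X) (t : R), (0 < t < 1)%R ->
    f (t *: x + (1 - t) *: y)%R <= t%:E * f x + (1 - t)%:E * f y.

Definition Gamma0 f := [/\ proper_efun f, lower_semicontinuous f & convex_efun f].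

(* The gradient as a set-valued operator: g is the Gateaux gradient of f at x.
   Difference quotients may be infinite for t away from 0. *)
Definition gateaux_gradient f (x : X) : set (topdual X) :=
  [set g | f x \is a fin_num /\
    forall v : X,
      (fun t : R => (t^-1)%:E * (f (x + t *: v)%R - f x)) @ 0%R^'
        --> (pairing v g)%:E].

Definition bregman f (x y : X) : \bar R :=
  if `[< (edom f)° y >] then
    f x - f y - (pairing (x - y)%R (svalue (gateaux_gradient f) y))%:E
  else +oo.

End convex_analysis.

(* Main.v *)
Require Import Defs.
From mathcomp Require Import all_boot all_order all_algebra.
From mathcomp Require Import all_classical all_reals all_analysis.
From mathcomp Require Import lra.

Import Order.TTheory GRing.Theory Num.Theory.
Import numFieldNormedType.Exports.

Local Open Scope classical_set_scope.
Local Open Scope ring_scope.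
Local Open Scope ereal_scope.

(** A point [z] of the warped proximal set of [x] comes with [xs] in [W x] and
[zs] in [W z] such that [xs - zs] is a subgradient of
[gamma * (phi - u)] at [z]. The subgradient inequality tested at the single
point [x] reads
[<x - z, xs - zs> <= gamma * ((phi x - <x, u>) - (phi z - <z, u>))],
and by the Fenchel-Young inequality at [z], [<z, u> - phi z <= phi^* u], the
right-hand side is at most [gamma * L_phi (x, u)]. Properness of [phi] makes
[phi z] finite, so that the rearrangement is legitimate in the extended reals
([subgradient_fenchel_young]). This gives the first claim
([warped_prox_witnesses]).

The other claims only rewrite or bound from below the product
[<x - z, xs - zs>]: monotonicity moduli bound it directly, single-valuedness
identifies [xs] and [zs] with the values of [W] at [x] and [z], and for a
gradient it is the symmetrized Bregman distance, in which the values of [f]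
cancel ([bregman_symmetrized]). A Gateaux gradient is at most single-valued
because limits in the extended reals are unique. *)

Lemma pairingBr {R : realType} {X : normedModType R} (x : X)
    (u v : topdual X) :
  pairing x (u - v)%R = (pairing x u - pairing x v)%R.
Proof. by []. Qed.

Lemma pairingBl {R : realType} {X : normedModType R} (x y : X)
    (u : topdual X) :
  pairing (x - y)%R u = (pairing x u - pairing y u)%R.
Proof. exact: linearB. Qed.

Lemma le_conjugate {R : realType} {X : normedModType R} (phi : X -> \bar R)
    (u : topdual X) (y : X) :
  (pairing y u)%:E - phi y <= conjugate phi u.
Proof. by apply: ereal_sup_ubound; exists y. Qed.

(** A subgradient inequality at a point where the function is infinite would
fail at any point of the domain. *)
Lemma subdifferential_fin_num {R : realType} {X : normedModType R}
    {phi : X -> \bar R} {z : X} {d : topdual X} :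
  proper_efun phi -> subdifferential phi z d -> phi z \is a fin_num.
Proof.
move=> [phi_gt [y yoo]] /(_ y) dzy; rewrite fin_real// phi_gt /= ltNge.
apply/negP; rewrite leye_eq => /eqP phiz.
by move: dzy yoo; rewrite /edom /= phiz addey// leye_eq => /eqP ->.
Qed.

(** Lets [subdifferential_fin_num] apply to the function whose subdifferential
enters the proximal set. *)
Lemma proper_scale_tilt {R : realType} {X : normedModType R}
    {phi : X -> \bar R} (u : topdual X) {gamma : R} :
  (0 < gamma)%R -> proper_efun phi ->
  proper_efun (fun y => gamma%:E * (phi y - (pairing y u)%:E)).
Proof.
move=> g0 [phi_gt [y yoo]]; split=> [t|].
  have := phi_gt t; case: (phi t) => [r _| _|]//=; first exact: ltNyr.
  by rewrite addye// gt0_muley.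
exists y; move: (phi_gt y) yoo; rewrite /edom /=.
by case: (phi y) => [r _ _|//|//]; exact: ltry.
Qed.

(** Everything reduces to real arithmetic: [phi z] is finite by properness, the
conjugate at [u] is then above the finite number [<z, u> - phi z], and if it or
[phi x] is infinite the right-hand side is [+oo]. *)
Lemma subgradient_fenchel_young {R : realType} {X : normedModType R}
    {phi : X -> \bar R} {u d : topdual X} {gamma : R} {x z : X} :
  (0 < gamma)%R -> proper_efun phi ->
  subdifferential (fun y => gamma%:E * (phi y - (pairing y u)%:E)) z d ->
  (pairing (x - z)%R d)%:E / gamma%:E <= fenchel_young phi x u.
Proof.
move=> g0 phi_proper dz.
have := subdifferential_fin_num (proper_scale_tilt u g0 phi_proper) dz.
have [phi_gt _] := phi_proper.
have := le_conjugate phi u z; have := dz x; rewrite /fenchel_young.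
case: (phi z) (phi_gt z) => [b _|_|//]; last by rewrite addye// gt0_muley.
case: (conjugate phi u) => [c||//]; last first.
  by case: (phi x) (phi_gt x) => [a _|_|//] _ _ _; rewrite ?addey// leey.
case: (phi x) (phi_gt x) => [a _|_|//]; last by rewrite !addye// leey.
rewrite inver gt_eqF// -!(EFinM, EFinB, EFinD) !lee_fin => dzx uz _.
rewrite ler_pdivrMr//; nra.
Qed.

Lemma warped_prox_witnesses {R : realType} {X : normedModType R}
    {phi : X -> \bar R} {W : X -> set (topdual X)} {u : topdual X}
    {gamma : R} {x z : X} :
  (0 < gamma)%R -> proper_efun phi ->
  warped_prox W (fun y => gamma%:E * (phi y - (pairing y u)%:E)) x z ->
  exists xs zs : topdual X, [/\ W x xs, W z zs &
    (pairing (x - z)%R (xs - zs)%R)%:E / gamma%:E <= fenchel_young phi x u].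
Proof.
move=> g0 phi_proper [xs Wxs [zs Wzs [d dz xsE]]].
exists xs, zs; split=> //; rewrite -xsE addrAC subrr add0r.
exact: subgradient_fenchel_young dz.
Qed.

Lemma svalueE {T : Type} {V : zmodType} {W : T -> set V} {x : T} {v : V} :
  is_subset1 (W x) -> W x v -> svalue W x = v.
Proof. by move=> W1 Wv; exact: xget_subset1. Qed.

Lemma gateaux_gradient_single_valued {R : realType} {X : normedModType R}
    (f : X -> \bar R) : at_most_single_valued (gateaux_gradient f).
Proof.
move=> x g h [_ gl] [_ hl]; apply/val_inj/funext => v.
suff [] : (pairing v g)%:E = (pairing v h)%:E by [].
exact: (cvg_unique (@ereal_hausdorff R) (gl v) (hl v)).
Qed.

(** The values of [f] cancel in the sum of the two Bregman distances because
they are finite wherever a Gateaux gradient exists. *)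
Lemma bregman_symmetrized {R : realType} {X : normedModType R}
    {f : X -> \bar R} {x z : X} {g h : topdual X} :
  (edom f)° x -> (edom f)° z ->
  gateaux_gradient f x g -> gateaux_gradient f z h ->
  bregman f x z + bregman f z x = (pairing (x - z)%R (g - h)%R)%:E.
Proof.
move=> xi zi gx hz; rewrite /bregman !asboolT//.
have single := gateaux_gradient_single_valued f.
rewrite (svalueE (single x) gx) (svalueE (single z) hz).
case: gx hz => + _ [+ _]; case: (f x) => // a _; case: (f z) => // b _.
rewrite -!(EFinB, EFinD) pairingBr !pairingBl; congr EFin; lra.
Qed.

Theorem proposition6p2 (R : realType) (X : completeNormedModType R)
    (X_neq0 : exists x : X, x != 0%R) (X_refl : reflexive_space X)
    (phi : X -> \bar R) (phi_proper : proper_efun phi)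
    (W : X -> set (topdual X)) (u : topdual X)
    (gamma : R) (gamma_gt0 : (0 < gamma)%R)
    (x z : X) (xW : sdom W x)
    (zx : warped_prox W (fun y => gamma%:E * (phi y - (pairing y u)%:E)) x z) :
  (exists xs zs : topdual X, W x xs /\ W z zs /\
     (pairing (x - z)%R (xs - zs)%R)%:E / gamma%:E <= fenchel_young phi x u) /\
  (forall psi : R -> \bar R, modulus psi -> uniformly_monotone psi W ->
     psi `|x - z|%R / gamma%:E <= fenchel_young phi x u) /\
  (forall alpha : R, (0 < alpha)%R -> strongly_monotone alpha W ->
     (alpha * `|x - z| ^+ 2)%:E / gamma%:E <= fenchel_young phi x u) /\
  (at_most_single_valued W ->
     sdom W z /\
     (pairing (x - z)%R (svalue W x - svalue W z)%R)%:E / gamma%:E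
       <= fenchel_young phi x u) /\
  (forall f : X -> \bar R, Gamma0 f ->
     sdom (gateaux_gradient f) = (edom f)° ->
     W = gateaux_gradient f ->
     (bregman f x z + bregman f z x) / gamma%:E <= fenchel_young phi x u).
Proof.
have [xs [zs [Wxs Wzs Lxu]]] := warped_prox_witnesses gamma_gt0 phi_proper zx.
have lb psi : uniformly_monotone psi W ->
    psi `|x - z|%R / gamma%:E <= fenchel_young phi x u.
  move=> Wmono; apply: le_trans Lxu.
  rewrite lee_wpmul2r//; last exact: Wmono.
  by rewrite inver gt_eqF// lee_fin invr_ge0 ltW.
split; first by exists xs, zs.
split; first by move=> psi _; exact: lb.
split; first by move=> alpha _ /lb.
split.
  move=> W1; split; first by exists zs.
  by rewrite (svalueE (W1 x) Wxs) (svalueE (W1 z) Wzs).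
move=> f _ domE WE; rewrite WE in Wxs Wzs.
by rewrite (bregman_symmetrized _ _ Wxs Wzs)// -domE; [exists xs|exists zs].
Qed.
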